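(* Let $(K,S,\{F_i\}_{i\in S})$ be a generalized Sierpiński carpet with parameters $D,a,S$, and suppose that $D=2$. Let $p>0$. Then $\rho_p>N_*^{-1}a^p$. In particular, $\beta_p:=\log(N_*\rho_p)/\log a$ satisfies $\beta_p>p$ for any $p>0$.
   Context: Generalized Sierpiński carpet. Let $D,a\in\mathbb N$ with $D\ge2$, $a\ge3$; $Q_0=[-1,1]^D$; $\emptyset\neq S\subsetneq\{0,1,\dots,a-1\}^D$; $\mathbf e_1,\dots,\mathbf e_D$ the standard basis of $\mathbb R^D$. For $i\in\{0,\dots,a-1\}^D$ let $f_i(x)=a^{-1}x+2a^{-1}i-(a-1)a^{-1}\sum_{j=1}^D\mathbf e_j$, $Q_1=\bigcup_{i\in S}f_i(Q_0)$, let $K$ be the unique non-empty compact subset of $\mathbb R^D$ with $K=\bigcup_{i\in S}f_i(K)$, and $F_i=f_i|_K$. The triple $(K,S,\{F_i\}_{i\in S})$ is a generalized Sierpiński carpet if: (GSC1) $f(Q_1)=Q_1$ for every isometry $f$ of $\mathbb R^D$ with $f(Q_0)=Q_0$; (GSC2) $Q_1$ is connected; (GSC3) $\mathrm{int}_{\mathbb R^D}\bigl(Q_1\cap\prod_{k=1}^D[2(i_k-\varepsilon_k)a^{-1}-1,\,2(i_k+1)a^{-1}-1]\bigr)$ is either empty or connected for all $(i_k)\in\mathbb Z^D$, $(\varepsilon_k)\in\{0,1\}^D$; (GSC4) $[-1,1]\times\{1\}^{D-1}\subset Q_1$. $N_*=\#S$. Words and graphs: $W_n=S^n$ ($n\ge1$),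 $W_\#=\bigcup_{n\ge1}W_n$, $|w|=n$ for $w\in W_n$; for $w=w_1\cdots w_n$, $F_w=F_{w_1}\circ\cdots\circ F_{w_n}$, $K_w=F_w(K)$; words are concatenated as $vw$, and $v\cdot W_n=\{vw: w\in W_n\}$. $G_n=(W_n,E_n)$ with $E_n=\{(v,w)\in W_n^2: v\ne w,\ K_v\cap K_w\ne\emptyset\}$; $d_{G_n}$ is its graph distance. For $w\in W_m$, $\mathcal B_n(w,1)=\bigcup_{v\in W_m,\,d_{G_m}(v,w)\le1}v\cdot W_n\subseteq W_{n+m}$. Energies: for a finite graph $G=(V,E)$ (with $E$ a symmetric set of ordered pairs) and $f:V\to\mathbb R$, $\mathcal E_p^G(f)=\frac12\sum_{(x,y)\in E}|f(x)-f(y)|^p$; for disjoint $A,B\subseteq V$, $\mathcal C_p^G(A,B)=\inf\{\mathcal E_p^G(f): f|_A\equiv1,\ f|_B\equiv0\}$. Set $\mathcal C_p^{(n)}=\sup_{w\in W_\#}\mathcal C_p^{G_{n+|w|}}\bigl(w\cdot W_n,\ W_{n+|w|}\setminus\mathcal B_n(w,1)\bigr)$ and $\rho_p^{-1}=\lim_{n\to\infty}(\mathcal C_p^{(n)})^{1/n}$ (for every $p>0$ the limit exists and $\rho_p\in(0,\infty)$). *)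

(* Defs.v *)
From HB Require Import structures.
From mathcomp Require Import all_boot all_order all_algebra.
From mathcomp Require Import all_classical all_reals all_analysis.

Set Implicit Arguments.
Unset Strict Implicit.
Unset Printing Implicit Defensive.

Import Order.TTheory GRing.Theory Num.Theory.
Import numFieldNormedType.Exports.

Local Open Scope classical_set_scope.
Local Open Scope ring_scope.

Section Carpet.
Variables (R : realType) (D a : nat).

Definition gsc_index := {ffun 'I_D -> 'I_a}.

Implicit Types (S : {set gsc_index}) (K : set 'rV[R]_D).

(* The library norm on ['rV[R]_D] is the sup norm, which has fewer isometries
   than the Euclidean distance. *)
Definition eucl_dist (x y : 'rV[R]_D) : R :=
  Num.sqrt (\sum_(j < D) (x 0 j - y 0 j) ^+ 2).

Definition eucl_isometry (f : 'rV[R]_D -> 'rV[R]_D) : Prop :=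
  forall x y, eucl_dist (f x) (f y) = eucl_dist x y.

Definition Q0 : set 'rV[R]_D := [set x | forall j, -1 <= x 0 j <= 1].

Definition simil (i : gsc_index) (x : 'rV[R]_D) : 'rV[R]_D :=
  a%:R^-1 *: x + (2 * a%:R^-1) *: (\row_(j < D) (i j : nat)%:R)
  - ((a%:R - 1) * a%:R^-1) *: \sum_(j < D) delta_mx 0 j.

Definition Q1 S : set 'rV[R]_D := \bigcup_(i in [set` S]) (simil i @` Q0).

(* By Hutchinson's theorem exactly one [K] satisfies this when [S] is
   non-empty and [a] is at least 2. *)
Definition self_similar_set S K : Prop :=
  [/\ K !=set0, compact K & K = \bigcup_(i in [set` S]) (simil i @` K)].

Definition gsc_box (i : 'I_D -> int) (eps : 'I_D -> bool) : set 'rV[R]_D :=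
  [set x | forall k,
     2 * (i k - (eps k : nat)%:Z)%:~R * a%:R^-1 - 1 <= x 0 k
       <= 2 * (i k + 1)%:~R * a%:R^-1 - 1].

Record generalized_sierpinski_carpet S K : Prop := {
  gsc_dim : (2 <= D)%N;
  gsc_scale : (3 <= a)%N;
  gsc_neq0 : S != finset.set0;
  gsc_proper : S \proper [set: gsc_index]%SET;
  gsc_attractor : self_similar_set S K;
  gsc_symmetry : forall f, eucl_isometry f -> f @` Q0 = Q0 ->
    f @` Q1 S = Q1 S;
  gsc_connected : connected (Q1 S);
  gsc_nondiagonal : forall i eps,
    let U := (Q1 S `&` gsc_box i eps)° in U = set0 \/ connected U;
  gsc_border :
    [set x : 'rV[R]_D | forall j : 'I_D,
       if (j : nat) == 0%N then -1 <= x 0 j <= 1 else x 0 j == 1] `<=` Q1 S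
}.

Definition letter S := {i : gsc_index | i \in S}.

Definition word S (n : nat) := n.-tuple (letter S).

Definition simil_word S n (w : word S n) : 'rV[R]_D -> 'rV[R]_D :=
  foldr (fun (i : letter S) g => simil (val i) \o g) id w.

Definition cell S K n (w : word S n) : set 'rV[R]_D := simil_word w @` K.

Definition word_edge S K n : rel (word S n) :=
  fun v w => (v != w) && `[< cell K v `&` cell K w !=set0 >].

End Carpet.

Section Graph.
Variables (R : realType) (V : finType) (E : rel V).

(* [+oo] when [x] and [y] are not connected. *)
Definition graph_dist (x y : V) : \bar R :=
  ereal_inf [set (size s)%:R%:E | s in [set s | path E x s /\ last x s = y]].

Definition energy (p : R) (f : V -> R) : R :=
  2^-1 * \sum_(e : V * V | E e.1 e.2) `|f e.1 - f e.2| `^ p.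

Definition capacity (p : R) (A B : {set V}) : \bar R :=
  ereal_inf [set (energy p f)%:E | f in
    [set f : V -> R | (forall x, x \in A -> f x = 1) /\
                      (forall x, x \in B -> f x = 0)]].

End Graph.

Section Conductance.
Variables (R : realType) (D a : nat) (S : {set gsc_index D a}) (K : set 'rV[R]_D).

Definition cylinder m n (w : word S m) : {set word S (m + n)} :=
  [set cat_tuple w u | u : word S n]%SET.

Definition nbhd_ball m n (w : word S m) : {set word S (m + n)} :=
  (\bigcup_(v : word S m |
     (graph_dist R (@word_edge R D a S K m) v w <= 1)%E) cylinder n v)%SET.

Definition conductance (p : R) (n : nat) : \bar R :=
  ereal_sup [set c | exists m (w : word S m), (0 < m)%N /\
    c = capacity (@word_edge R D a S K (m + n)) p
          (cylinder n w) (~: nbhd_ball n w)%SET].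

(* [rho] is the inverse of the limit of the n-th roots, which exists in
   ]0, +oo[ for every p > 0; this predicate determines it uniquely. *)
Definition is_scaling_factor (p rho : R) : Prop :=
  0 < rho /\
  (fun n : nat => (conductance p n `^ n%:R^-1)%E) @ \oo --> (rho^-1)%:E.

Definition beta_exponent (rho : R) : R := ln (#|S|%:R * rho) / ln a%:R.

End Conductance.

(* Main.v *)
(* A function of one coordinate only, with increments mu_c in the columns
   c < a at each scale (sum of the mu_c equal to 1), has at depth n an energy of
   order (sum_c N_c mu_c^p)^n, where N_c is the number of cells in column c.
   The uniform choice mu_c = 1/a gives the trivial bound (N_* a^-p)^n. Since a
   boundary column is full and some other column is not, the N_c are not all
   equal, and moving a little mass from a full column to a deficient one makes
   the sum strictly smaller than N_* a^-p. Cutting these functions off by a tent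
   and taking the minimum over both axes gives an admissible function for every
   capacity, because two distinct cells meet iff their grid squares do: grid
   squares that meet share a corner, and the attractor contains the corners of
   its bounding square. *)

Require Import Defs.
From HB Require Import structures.
From mathcomp Require Import all_boot all_order all_algebra.
From mathcomp Require Import all_classical all_reals all_analysis.
From mathcomp Require Import ring lra zify.

Set Implicit Arguments.
Unset Strict Implicit.
Unset Printing Implicit Defensive.

Import Order.TTheory GRing.Theory Num.Theory.
Import numFieldNormedType.Exports.

Local Open Scope classical_set_scope.
Local Open Scope ring_scope.

(** * Perturbing the uniform weights *)

(** The weights [1 - t] at [c1] and [1 + t] at [c2], scaled by [1/#|I|], win to first order in [t].
    The bound [1 + x <= expR x] turns the two powers into [expR (- s)] and [expR s] with
    [s = t * p], so no convexity is used and [p < 1] is covered. *)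
Lemma nonuniform_weights (R : realType) (I : finType) (N : I -> R) (p : R)
    (c1 c2 : I) :
  0 < p -> 0 <= N c2 -> N c2 < N c1 ->
  exists mu : I -> R, [/\ forall c, 0 <= mu c, \sum_c mu c = 1 &
    \sum_c N c * mu c `^ p < (\sum_c N c) * #|I|%:R^-1 `^ p].
Proof.
move=> p0 N20 N21; have N10 : 0 < N c1 by apply: le_lt_trans N21.
have c12 : c2 != c1 by apply: contraTneq N21 => ->; rewrite ltxx.
have I0 : 0 < #|I|%:R :> R by rewrite ltr0n; apply/card_gt0P; exists c1.
pose k : R := #|I|%:R^-1; have k0 : 0 < k by rewrite invr_gt0.
(* The first bound on [s] gives [t <= 1], so the weights stay nonnegative; the second gives [N c1 *
   (1 - s) >= (N c1 + N c2) / 2 > N c2]. *)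
pose s := Num.min p ((N c1 - N c2) / (2 * N c1)).
have s0 : 0 < s by rewrite lt_min p0 divr_gt0 ?subr_gt0 ?mulr_gt0.
have sp : s <= p by rewrite ge_min lexx.
have sN : s * (2 * N c1) <= N c1 - N c2.
  by rewrite -ler_pdivlMr ?mulr_gt0// ge_min lexx orbT.
pose t := s / p.
have t0 : 0 < t by rewrite divr_gt0.
have t1 : t <= 1 by rewrite ler_pdivrMr ?mul1r.
pose d c : R := if c == c1 then - t else if c == c2 then t else 0.
have d1 c : 0 <= 1 + d c by rewrite /d; case: ifP => _; [|case: ifP => _]; lra.
exists (fun c => k * (1 + d c)); split.
- by move=> c; rewrite mulr_ge0 // ltW.
- rewrite -mulr_sumr big_split/= sumr_const /=.
  rewrite (bigD1 c1)//= (bigD1 c2)//= /d eqxx (negbTE c12) eqxx.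
  rewrite big1 => [|i /andP[/negbTE -> /negbTE ->]//].
  by rewrite addr0 addNr addr0 /k mulVf// gt_eqF.
under eq_bigr => c _ do rewrite powRM ?(ltW k0)// mulrCA.
rewrite -mulr_sumr mulrC ltr_pM2r ?powR_gt0//.
have split2 (F : I -> R) : \sum_c F c =
    F c1 + F c2 + \sum_(c | (c != c1) && (c != c2)) F c.
  by rewrite (bigD1 c1)//= (bigD1 c2)//= addrA.
rewrite !split2; apply: ltr_leD; last first.
  apply: ler_sum => c /andP[/negbTE h1 /negbTE h2].
  by rewrite /d h1 h2 addr0 powR1 mulr1.
rewrite /d eqxx (negbTE c12) eqxx.
have powle x : 0 <= 1 + x -> (1 + x) `^ p <= expR (x * p).
  move=> x0; rewrite expRM; apply: ge0_ler_powR; rewrite ?nnegrE ?expR_ge0//.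
    exact: ltW.
  exact: expR_ge1Dx.
have tp : t * p = s by rewrite /t mulfVK// gt_eqF.
have h1 : (1 + - t) `^ p <= expR (- s).
  by apply: le_trans (powle _ _) _; [lra|rewrite mulNr tp].
have h2 : (1 + t) `^ p <= expR s.
  by apply: le_trans (powle _ _) _; [lra|rewrite tp].
have E1 : 1 < expR s by rewrite expR_gt1.
have E2 : 1 + - s <= expR (- s) by exact: expR_ge1Dx.
have E3 : expR s * expR (- s) = 1 by rewrite expRxMexpNx_1.
have m1 : N c1 * (1 + - t) `^ p <= N c1 * expR (- s) by rewrite ler_pM2l.
have m2 : N c2 * (1 + t) `^ p <= N c2 * expR s by rewrite ler_wpM2l.
apply: le_lt_trans (lerD m1 m2) _.
have E4 : N c2 < N c1 * expR (- s).
  apply: lt_le_trans (_ : N c1 * (1 + - s) <= _); last by rewrite ler_pM2l.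
  nra.
(* the gap is (e^s - 1) (N c1 e^{-s} - N c2) *)
rewrite -subr_gt0.
have -> : N c1 + N c2 - (N c1 * expR (- s) + N c2 * expR s) =
  (expR s - 1) * (N c1 * expR (- s) - N c2).
  by rewrite mulrBl !mulrBr mulrCA E3; ring.
by rewrite mulr_gt0// subr_gt0.
Qed.

(** * Digit masses and their distribution function *)

(* With [mu] of total mass 1 on the digits [0, a[, this is the mass of the
   [k]-th interval of length a^-n inside its unit interval. *)
Definition digit_mass (R : realType) (a : nat) (mu : nat -> R) (n k : nat) : R :=
  \prod_(i < n) mu ((k %/ a ^ i) %% a)%N.

(** The distribution function of the multinomial measure with weights [mu], repeated with period
    [a ^ n]: one level-[m] interval has mass 1 when cut into [a ^ n] pieces. *)
Definition cumulative_mass (R : realType) (a : nat) (mu : nat -> R)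
    (n X : nat) : R :=
  \sum_(0 <= k < X) digit_mass a mu n k.

Lemma digit_mass_ge0 (R : realType) a (mu : nat -> R) n k :
  (forall c, 0 <= mu c) -> 0 <= digit_mass a mu n k.
Proof. by move=> mu0; apply: prodr_ge0. Qed.

Lemma digit_mass_cons (R : realType) a (mu : nat -> R) n h k :
  (h < a)%N -> (k < a ^ n)%N ->
  digit_mass a mu n.+1 (h * a ^ n + k) = mu h * digit_mass a mu n k.
Proof.
move=> ha ka; have an0 : (0 < a ^ n)%N by apply: leq_ltn_trans ka.
rewrite /digit_mass big_ord_recr/= mulrC; congr (_ * _).
  by rewrite divnMDl// divn_small// addn0 modn_small.
apply: eq_bigr => i _; congr mu.
(* For [i < n] the term [h * a ^ n] is a multiple of [a ^ i.+1], so it leaves the [i]-th digit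
   unchanged. *)
have -> : (h * a ^ n = h * a ^ (n - i.+1) * a * a ^ i)%N.
  by rewrite -!mulnA -expnS -expnD; congr (_ * a ^ _)%N; have := ltn_ord i; lia.
by rewrite divnMDl ?modnMDl// expn_gt0; move: ha; case: (a).
Qed.

Lemma digit_massMDl (R : realType) a (mu : nat -> R) n q k :
  (0 < a)%N -> digit_mass a mu n (q * a ^ n + k) = digit_mass a mu n k.
Proof.
move=> a0; apply: eq_bigr => i _; congr mu.
have -> : (q * a ^ n = q * a ^ (n - i.+1) * a * a ^ i)%N.
  by rewrite -!mulnA -expnS -expnD; congr (_ * a ^ _)%N; have := ltn_ord i; lia.
by rewrite divnMDl ?modnMDl// expn_gt0 a0.
Qed.

Lemma sum_nat_mul (R : realType) (F : nat -> R) q b :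
  \sum_(0 <= k < q * b) F k = \sum_(0 <= h < q) \sum_(0 <= k < b) F (h * b + k)%N.
Proof.
elim: q => [|q IH]; first by rewrite mul0n !big_geq.
rewrite big_nat_recr//= -IH mulSnr (big_cat_nat _ (n := q * b))//= ?leq_addr//.
congr (_ + _); rewrite -{1}[(q * b)%N]add0n big_addn addKn.
by apply: eq_bigr => i _; rewrite addnC.
Qed.

Lemma cumulative_mass_exp (R : realType) a (mu : nat -> R) n :
  \sum_(0 <= c < a) mu c = 1 -> cumulative_mass a mu n (a ^ n) = 1.
Proof.
move=> mu1; rewrite /cumulative_mass; elim: n => [|n IH].
  by rewrite big_nat1 /digit_mass big_ord0.
rewrite expnS sum_nat_mul -[RHS]mu1 !big_nat; apply: eq_bigr => h ha.
rewrite -[RHS]mulr1 -IH mulr_sumr !big_nat; apply: eq_bigr => k ka.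
exact: digit_mass_cons.
Qed.

Lemma cumulative_mass_mul (R : realType) a (mu : nat -> R) n q :
  (0 < a)%N -> \sum_(0 <= c < a) mu c = 1 ->
  cumulative_mass a mu n (q * a ^ n) = q%:R.
Proof.
move=> a0 mu1; rewrite /cumulative_mass sum_nat_mul.
under eq_bigr do under eq_bigr do rewrite digit_massMDl//.
have -> : \sum_(0 <= k < a ^ n) digit_mass a mu n k = 1.
  exact: cumulative_mass_exp.
by rewrite sumr_const_nat subn0.
Qed.

Lemma cumulative_mass_le (R : realType) a (mu : nat -> R) n :
  (forall c, 0 <= mu c) ->
  {homo cumulative_mass a mu n : X Y / (X <= Y)%N >-> X <= Y}.
Proof.
move=> mu0 X Y XY; rewrite /cumulative_mass [leRHS](big_cat_nat _ (n := X))//= lerDl.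
by apply: sumr_ge0 => k _; apply: digit_mass_ge0.
Qed.

(** For neighbours the difference is the mass of the interval between them, indexed by the smaller
    of [X] and [Y]; the maximum keeps the bound symmetric. *)
Lemma cumulative_mass_step (R : realType) a (mu : nat -> R) n X Y :
  (forall c, 0 <= mu c) -> (X <= Y.+1)%N -> (Y <= X.+1)%N ->
  `|cumulative_mass a mu n X - cumulative_mass a mu n Y|
    <= Num.max (digit_mass a mu n X) (digit_mass a mu n Y).
Proof.
move=> mu0; wlog XY : X Y / (X <= Y)%N => [hw h1 h2|].
  have [XY|/ltnW XY] := leqP X Y; first exact: hw.
  by rewrite distrC maxC; apply: hw.
move=> _; rewrite leq_eqVlt ltnS => /orP[/eqP ->|YX].
  rewrite distrC /cumulative_mass big_nat_recr//= addrAC subrr add0r.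
  by rewrite ger0_norm ?le_max ?lexx// digit_mass_ge0.
have -> : Y = X by apply/eqP; rewrite eqn_leq YX.
by rewrite subrr normr0 le_max digit_mass_ge0.
Qed.

(** * Grid coordinates of words *)

Fixpoint word_coord (D a : nat) (S : {set gsc_index D a}) (j : 'I_D)
    (s : seq (letter S)) : nat :=
  if s is h :: t then (val h j * a ^ size t + word_coord j t)%N else 0.

Lemma word_coord_lt D a (S : {set gsc_index D a}) j (s : seq (letter S)) :
  (word_coord j s < a ^ size s)%N.
Proof.
elim: s => [|h t IH]//=; rewrite expnS.
apply: (@leq_trans ((val h j).+1 * a ^ size t)).
  by rewrite mulSn addnC ltn_add2r.
by rewrite leq_mul2r ltn_ord orbT.
Qed.

Lemma word_coord_cat D a (S : {set gsc_index D a}) j (s t : seq (letter S)) :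
  word_coord j (s ++ t) = (word_coord j s * a ^ size t + word_coord j t)%N.
Proof.
elim: s => [|h s IH]//=.
by rewrite IH size_cat expnD mulnDl addnA mulnA.
Qed.

Lemma word_coord_inj D a (S : {set gsc_index D a}) n (v w : word S n) :
  (forall j, word_coord j v = word_coord j w) -> v = w.
Proof.
move=> vw; apply: val_inj => /=; move: vw.
case: v w => [v /= /eqP sv] [w /= /eqP sw].
elim: n v w sv sw => [|n IH] [|h v] [|g w]//= [sv] [sw] vw.
have e j : val h j = val g j :> nat /\ word_coord j v = word_coord j w.
  have := vw j; have := word_coord_lt j v; have := word_coord_lt j w.
  rewrite sv sw => lw lv E.
  have a0 : (0 < a ^ n)%N by apply: leq_ltn_trans lv.
  have q := congr1 (divn^~ (a ^ n)%N) E; have r := congr1 (modn^~ (a ^ n)%N) E.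
  rewrite /= !divnMDl// !divn_small// !addn0 in q.
  by rewrite /= !modnMDl !modn_small// in r.
congr (_ :: _); last by apply: IH => // j; have [] := e j.
by apply: val_inj; apply/ffunP => j; apply: val_inj; have [] := e j.
Qed.

(** A sup-distance on grid positions that does not mention [K]; for [r = 1] it says that the two
    grid squares meet. *)
Definition near_words (D a : nat) (S : {set gsc_index D a}) (n r : nat) :
    rel (word S n) :=
  fun v w => [forall j, (word_coord j v <= word_coord j w + r)%N &&
                        (word_coord j w <= word_coord j v + r)%N].

Lemma near_words_sym D a (S : {set gsc_index D a}) n r :
  symmetric (@near_words D a S n r).
Proof. by move=> v w; apply: eq_forallb => j; rewrite andbC. Qed.

Lemma near_words_trans D a (S : {set gsc_index D a}) n r1 r2
    (u v w : word S n) :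
  near_words r1 u v -> near_words r2 v w -> near_words (r1 + r2) u w.
Proof.
move=> /forallP h1 /forallP h2; apply/forallP => j.
by move: (h1 j) (h2 j); lia.
Qed.

Lemma near_words_le D a (S : {set gsc_index D a}) n r1 r2 (v w : word S n) :
  (r1 <= r2)%N -> near_words r1 v w -> near_words r2 v w.
Proof.
move=> r12 /forallP h1; apply/forallP => j; by move: (h1 j); lia.
Qed.

Lemma card_near_words D a (S : {set gsc_index D a}) n r (w : word S n) :
  (#|[set v | near_words r v w]%SET| <= (2 * r).+1 ^ D)%N.
Proof.
(* Adding [r] before subtracting prevents truncation: the offset from [w] is encoded in
   [[0, 2r]]. *)
pose f (v : word S n) : {ffun 'I_D -> 'I_((2 * r).+1)} :=
  [ffun j => inord (word_coord j v + r - word_coord j w)%N].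
have f_inj : {in [set v | near_words r v w]%SET &, injective f}.
  move=> u v; rewrite !inE => /forallP hu /forallP hv /ffunP E.
  apply: word_coord_inj => j; have := congr1 val (E j).
  by rewrite /= !ffunE !inordK; move: (hu j) (hv j); lia.
rewrite -(card_in_imset f_inj); apply: leq_trans (max_card _) _.
by rewrite card_ffun !card_ord.
Qed.

(** If two ancestors differ by at least 2 in a coordinate, a full block of length [a ^ n] lies
    between their descendants, whose coordinates then differ by at least [a ^ n + 1]. *)
Lemma near_words_cat D a (S : {set gsc_index D a}) m n
    (u v : word S m) (x y : word S n) :
  near_words 1 (cat_tuple u x) (cat_tuple v y) -> near_words 1 u v.
Proof.
move=> /forallP h; apply/forallP => j; have := h j.
rewrite /= !word_coord_cat !size_tuple.
have := word_coord_lt j x; have := word_coord_lt j y; rewrite !size_tuple.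
move: (word_coord _ _) (word_coord _ _) (word_coord _ _) (word_coord _ _).
move=> X Y U V; move: (a ^ n)%N => b; clear; nia.
Qed.

Lemma cat_tuple_bij D a (S : {set gsc_index D a}) m n :
  bijective (fun q : word S m * word S n => cat_tuple q.1 q.2 : word S (m + n)).
Proof.
apply: inj_card_bij; last by rewrite card_prod !card_tuple expnD.
move=> [u x] [v y] /(congr1 val)/= /eqP; rewrite eqseq_cat ?size_tuple//.
by move=> /andP[/eqP e1 /eqP e2]; congr (_, _); apply: val_inj.
Qed.

Lemma sum_word_cat (R : realType) D a (S : {set gsc_index D a}) m n
    (F : word S (m + n) -> R) :
  \sum_v F v = \sum_u \sum_x F (cat_tuple u x).
Proof. by rewrite pair_big/= (reindex _ (onW_bij _ (cat_tuple_bij S m n))). Qed.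

(** The mass of a word is the product of the weights of its letters, so the sum over words
    factors. *)
Lemma sum_word_coord_mass (R : realType) D a (S : {set gsc_index D a}) n j
    (mu : nat -> R) (p : R) :
  (0 < a)%N -> 0 < p -> (forall c, 0 <= mu c) ->
  \sum_(x : word S n) digit_mass a mu n (word_coord j x) `^ p
    = (\sum_(i in S) mu (i j) `^ p) ^+ n.
Proof.
move=> a0 p0 mu0; elim: n => [|n IH].
  rewrite expr0 (big_pred1 [tuple]) => [|x]; last by rewrite [x]tuple0/= eqxx.
  by rewrite /digit_mass big_ord0 powR1.
rewrite exprS -IH.
have -> : \sum_(i in S) mu (i j) `^ p = \sum_(h : letter S) mu (val h j) `^ p.
  exact: (big_sub (mem S) (fun i : gsc_index D a => mu (i j) `^ p)).
rewrite big_distrlr pair_big/=.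
pose f (q : letter S * word S n) : word S n.+1 := cons_tuple q.1 q.2.
rewrite (reindex f)/=; last first.
  exists (fun w => (thead w, behead_tuple w)) => [[h t]|w] _.
    by congr (_, _); apply: val_inj.
  by rewrite [RHS]tuple_eta; apply: val_inj.
apply: eq_bigr => -[h t] _ /=.
rewrite size_tuple digit_mass_cons ?ltn_ord//; last first.
  by have := word_coord_lt j t; rewrite size_tuple.
by rewrite powRM// digit_mass_ge0.
Qed.

(** * Tents and cutoff functions *)

(* Innermost extrema first, so that the hypotheses left for [lra] are linear. *)
Local Ltac case_minmax :=
  repeat match goal with
  | |- context [Order.min ?x ?y] =>
    lazymatch constr:((x, y)) with
    | context [Order.min _ _] => fail
    | context [Order.max _ _] => fail
    | _ => case: (ltP x y) => ?
    end
  | |- context [Order.max ?x ?y] =>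
    lazymatch constr:((x, y)) with
    | context [Order.min _ _] => fail
    | context [Order.max _ _] => fail
    | _ => case: (ltP x y) => ?
    end
  end.

(** The plateau [[q, q + 1]] is the interval of a level-[m] cell with coordinate [q], and the two
    slopes occupy the adjacent intervals. *)
Definition tent (R : realType) (q t : R) : R :=
  Num.max 0 (Num.min 1 (Num.min (t - (q - 1)) (q + 2 - t))).

Lemma tent_lipschitz (R : realType) (q s t : R) :
  `|tent q s - tent q t| <= `|s - t|.
Proof.
have := ler_norm (s - t); have := ler_norm (t - s); rewrite (distrC t s).
move: `|s - t| => d ? ?; rewrite ler_norml /tent.
by case_minmax; apply/andP; lra.
Qed.

Lemma tent_ge0 (R : realType) (q t : R) : 0 <= tent q t.
Proof. by rewrite /tent le_max lexx. Qed.

Lemma tent_eq1 (R : realType) (q t : R) : q <= t <= q + 1 -> tent q t = 1.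
Proof.
move=> /andP[? ?]; rewrite /tent.
by case_minmax; lra.
Qed.

Lemma tent_eq0 (R : realType) (q t : R) :
  (t <= q - 1) || (q + 2 <= t) -> tent q t = 0.
Proof.
move=> /orP ?; rewrite /tent.
by case_minmax; lra.
Qed.

(** The minimum is 1-Lipschitz for the sup norm, and the [p]-th power of a maximum is one of the two
    powers; hence no constant depending on [p] appears. *)
Lemma minr_lipschitz (R : realType) (x x' y y' p s t : R) : 0 < p ->
  `|x - y| `^ p <= s -> `|x' - y'| `^ p <= t ->
  `|Num.min x x' - Num.min y y'| `^ p <= s + t.
Proof.
move=> p0 hs ht.
have s0 : 0 <= s by apply: le_trans hs; rewrite powR_ge0.
have t0 : 0 <= t by apply: le_trans ht; rewrite powR_ge0.
have : `|Num.min x x' - Num.min y y'| <= Num.max `|x - y| `|x' - y'|.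
  have := ler_norm (x - y); have := ler_norm (y - x); rewrite (distrC y x).
  have := ler_norm (x' - y'); have := ler_norm (y' - x'); rewrite (distrC y' x').
  move: `|x - y| `|x' - y'| => d d' ? ? ? ?; rewrite ler_norml.
  by case_minmax; apply/andP; lra.
rewrite le_max => /orP[h|h].
- apply: le_trans (_ : s <= _); last by rewrite lerDl.
  by apply: le_trans hs; apply: ge0_ler_powR; rewrite ?nnegrE// ltW.
- apply: le_trans (_ : t <= _); last by rewrite lerDr.
  by apply: le_trans ht; apply: ge0_ler_powR; rewrite ?nnegrE// ltW.
Qed.

(** Complete blocks have mass 1, so all descendants of [u] are sent into the unit interval at the
    coordinate of [u], whatever the weights. *)
Lemma cumulative_mass_cat (R : realType) D a (S : {set gsc_index D a})
    (mu : nat -> R) m n j (u : word S m) (x : word S n) :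
  (0 < a)%N -> (forall c, 0 <= mu c) -> \sum_(0 <= c < a) mu c = 1 ->
  (word_coord j u)%:R
    <= cumulative_mass a mu n (word_coord j (cat_tuple u x))
    <= (word_coord j u)%:R + 1.
Proof.
move=> a0 mu0 mu1; have xn := word_coord_lt j x; rewrite size_tuple in xn.
rewrite natr1 -!(@cumulative_mass_mul _ a mu n)//= word_coord_cat size_tuple.
by rewrite !cumulative_mass_le ?leq_addr// mulSn addnC leq_add2r ltnW.
Qed.

Definition cutoff (R : realType) D a (S : {set gsc_index D a})
    (mu : 'I_D -> nat -> R) m n (w : word S m) (v : word S (m + n)) : R :=
  \big[Num.min/1]_j tent (word_coord j w)%:R
    (cumulative_mass a (mu j) n (word_coord j v)).

(** The depth [n] is separate from the length [l]: on words of length [m + n] only the last [n]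
    letters are weighted. *)
Definition word_mass (R : realType) D a (S : {set gsc_index D a})
    (mu : 'I_D -> nat -> R) (p : R) n l (v : word S l) : R :=
  \sum_j digit_mass a (mu j) n (word_coord j v) `^ p.

Lemma word_mass_ge0 (R : realType) D a (S : {set gsc_index D a})
    (mu : 'I_D -> nat -> R) (p : R) n l (v : word S l) :
  0 <= word_mass mu p n v.
Proof. by apply: sumr_ge0 => j _; apply: powR_ge0. Qed.

Lemma cutoff_eq1 (R : realType) D a (S : {set gsc_index D a})
    (mu : 'I_D -> nat -> R) m n (w : word S m) (x : word S n) :
  (0 < a)%N -> (forall j c, 0 <= mu j c) ->
  (forall j, \sum_(0 <= c < a) mu j c = 1) ->
  cutoff mu w (cat_tuple w x) = 1.
Proof.
move=> a0 mu0 mu1; apply: bigmin_eq_id => j _; rewrite tent_eq1//.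
exact: cumulative_mass_cat.
Qed.

Lemma cutoff_eq0 (R : realType) D a (S : {set gsc_index D a})
    (mu : 'I_D -> nat -> R) m n (w u : word S m) (x : word S n) :
  (0 < a)%N -> (forall j c, 0 <= mu j c) ->
  (forall j, \sum_(0 <= c < a) mu j c = 1) ->
  ~~ near_words 1 u w -> cutoff mu w (cat_tuple u x) = 0.
Proof.
move=> a0 mu0 mu1; rewrite negb_forall => /existsP[j].
have /andP[ge le] := cumulative_mass_cat j u x a0 (mu0 j) (mu1 j).
rewrite negb_and -!ltnNge !addn1 => far.
have e0 : tent (word_coord j w)%:R
    (cumulative_mass a (mu j) n (word_coord j (cat_tuple u x))) = 0 :> R.
  (* A coordinate gap of at least 2 leaves the unit interval of [u] outside the support of the tent,
     except possibly for an endpoint, where the tent vanishes. *)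
  apply: tent_eq0; case/orP: far => h; apply/orP; [right|left].
    by apply: le_trans ge; rewrite -natrD ler_nat addn2.
  by apply: le_trans le _; rewrite lerBrDr !natr1 ler_nat.
apply/eqP; rewrite eq_le; apply/andP; split.
  by apply: le_trans (bigmin_le _ j _) _; rewrite e0.
by apply: le_bigmin => // i _; apply: tent_ge0.
Qed.

Lemma cutoff_step (R : realType) D a (S : {set gsc_index D a})
    (mu : 'I_D -> nat -> R) (p : R) m n (w : word S m) (v v' : word S (m + n)) :
  0 < p -> (forall j c, 0 <= mu j c) -> near_words 1 v v' ->
  `|cutoff mu w v - cutoff mu w v'| `^ p
    <= word_mass mu p n v + word_mass mu p n v'.
Proof.
move=> p0 mu0 /forallP vv'; rewrite /cutoff /word_mass -big_split/=.
(* One induction over the axes runs through both minima and the sum of masses. *)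
apply: (big_rec3 (fun x y s : R => `|x - y| `^ p <= s)) => [|j x y s _ IH].
  by rewrite subrr normr0 powR0// gt_eqF.
apply: minr_lipschitz => //.
have /andP[h1 h2] := vv' j; rewrite !addn1 in h1 h2.
set P := digit_mass _ _ _ _; set Q := digit_mass _ _ _ _.
have h : `|tent (word_coord j w)%:R (cumulative_mass a (mu j) n (word_coord j v))
    - tent (word_coord j w)%:R (cumulative_mass a (mu j) n (word_coord j v'))|
    <= Num.max P Q.
  apply: le_trans (tent_lipschitz _ _ _) _; exact: cumulative_mass_step.
apply: (@le_trans _ _ (Num.max P Q `^ p)).
  apply: ge0_ler_powR; rewrite ?nnegrE ?(ltW p0)//.
  by rewrite le_max digit_mass_ge0.
by rewrite /Num.max; case: ifP => _; rewrite ?lerDl ?lerDr powR_ge0.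
Qed.

(** * Energy and conductance bounds *)

(** There are at most [(2r + 1) ^ D] ancestors [u]; the masses ignore the prefix [u], so each
    contributes at most [Theta ^+ n] per axis. *)
Lemma sum_word_mass (R : realType) D a (S : {set gsc_index D a})
    (mu : 'I_D -> nat -> R) (p Theta : R) m n (w : word S m) r :
  (0 < a)%N -> 0 < p -> (forall j c, 0 <= mu j c) ->
  (forall j, \sum_(i in S) mu j (i j) `^ p <= Theta) ->
  \sum_(u | near_words r u w) \sum_(x : word S n)
      word_mass mu p n (cat_tuple u x)
    <= ((2 * r).+1 ^ D * D)%:R * Theta ^+ n.
Proof.
move=> a0 p0 mu0 muT.
have E (u : word S m) : \sum_(x : word S n) word_mass mu p n (cat_tuple u x)
    <= D%:R * Theta ^+ n.
  rewrite exchange_big/= -[X in X%:R]card_ord mulr_natl -sumr_const.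
  apply: ler_sum => j _.
  under eq_bigr do rewrite word_coord_cat size_tuple digit_massMDl//.
  rewrite sum_word_coord_mass//; apply: lerXn2r; rewrite ?nnegrE//.
    by apply: sumr_ge0 => i _; apply: powR_ge0.
  by apply: le_trans (muT j); apply: sumr_ge0 => i _; apply: powR_ge0.
have T0 : 0 <= D%:R * Theta ^+ n.
  by apply: le_trans (E w); do 2!apply: sumr_ge0 => ? _; apply: powR_ge0.
apply: le_trans (ler_sum _ (fun u _ => E u)) _.
rewrite sumr_const natrM -mulrA -[leLHS]mulr_natl ler_wpM2r// ler_nat.
by apply: leq_trans (card_near_words r w); rewrite cardsE.
Qed.

(* Only pairs with an endpoint near [w] contribute to the energy of the cutoff,
   so both endpoints then have level-[m] ancestors within 2 of [w]. *)
Lemma energy_cutoff_le (R : realType) D a (S : {set gsc_index D a})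
    (K : set 'rV[R]_D) (mu : 'I_D -> nat -> R) (p Theta : R) m n (w : word S m) :
  (0 < a)%N -> 0 < p -> (forall j c, 0 <= mu j c) ->
  (forall j, \sum_(0 <= c < a) mu j c = 1) ->
  (forall j, \sum_(i in S) mu j (i j) `^ p <= Theta) ->
  (forall v v' : word S (m + n), word_edge K v v' -> near_words 1 v v') ->
  energy (@word_edge R D a S K (m + n)) p (@cutoff R D a S mu m n w)
    <= (3 ^ D * (5 ^ D * D))%:R * Theta ^+ n.
Proof.
move=> a0 p0 mu0 mu1 muT edge_near.
have [g gK Kg] := cat_tuple_bij S m n.
(* The energy of an edge is charged to its endpoints through [psi]. *)
pose psi v := if near_words 2 (g v).1 w then word_mass mu p n v else 0.
have psi0 v : 0 <= psi v by rewrite /psi; case: ifP => // _; apply: word_mass_ge0.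
have term v v' : near_words 1 v v' ->
    `|cutoff mu w v - cutoff mu w v'| `^ p <= psi v + psi v'.
  rewrite /psi -(Kg v) -(Kg v') !gK; case: (g v) (g v') => [u x] [u' x'] /=.
  move=> vv'; have uu' := near_words_cat vv'.
  have [near_w|] := boolP (near_words 1 u w || near_words 1 u' w); last first.
    rewrite negb_or => /andP[h h'].
    rewrite !cutoff_eq0// subrr normr0 powR0 ?gt_eqF//.
    by rewrite addr_ge0//; case: ifP => // _; apply: word_mass_ge0.
  rewrite !ifT; first exact: cutoff_step.
    case/orP: near_w => [h|]; last exact: near_words_le.
    by apply: (near_words_trans (r1 := 1) (r2 := 1)) h; rewrite near_words_sym.
  case/orP: near_w => [|h]; first exact: near_words_le.
  exact: (near_words_trans (r1 := 1) (r2 := 1)) h.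
(* A word has at most [3 ^ D] near words, itself included. *)
have deg (F : word S (m + n) -> R) : (forall v, 0 <= F v) ->
    \sum_(e : word S (m + n) * word S (m + n) | near_words 1 e.1 e.2) F e.1
      <= (3 ^ D)%:R * \sum_v F v.
  move=> F0; rewrite -(pair_big_dep xpredT (near_words 1) (fun v _ => F v))/=.
  rewrite mulr_sumr; apply: ler_sum => v _.
  rewrite sumr_const -[leLHS]mulr_natl ler_wpM2r// ler_nat.
  apply: leq_trans (card_near_words 1 v); rewrite cardsE.
  by apply/eq_leq/eq_card => v'; apply: near_words_sym.
have sum_psi : \sum_v psi v <= (5 ^ D * D)%:R * Theta ^+ n.
  apply: le_trans (sum_word_mass n w 2 a0 p0 mu0 muT).
  rewrite sum_word_cat [leRHS]big_mkcond/=; apply: ler_sum => u _.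
  under eq_bigr do rewrite /psi (gK (u, _))/=.
  by case: ifP => // _; rewrite big1_eq.
(* The factor 1/2 of the energy compensates for the two endpoint sums, which agree by swapping the
   pair. *)
rewrite /energy natrM -mulrA mulrC ler_pdivrMr// mulrC.
apply: le_trans (_ : \sum_(e : word S (m + n) * word S (m + n) |
    near_words 1 e.1 e.2) (psi e.1 + psi e.2) <= _).
  rewrite big_mkcond [leRHS]big_mkcond/=; apply: ler_sum => -[v v'] _ /=.
  case: ifPn => [/edge_near vv'|_]; first by rewrite vv' term.
  by case: ifP => // _; rewrite addr_ge0.
rewrite big_split/= mulr2n mulrDl !mul1r; apply: lerD.
  by apply: le_trans (deg _ psi0) _; rewrite ler_wpM2l.
have swapK : involutive (fun e : word S (m + n) * word S (m + n) => (e.2, e.1)).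
  by case.
rewrite (reindex_inj (inv_inj swapK))/=.
under eq_bigl do rewrite near_words_sym.
by apply: le_trans (deg _ psi0) _; rewrite ler_wpM2l.
Qed.

Lemma conductance_le (R : realType) D a (S : {set gsc_index D a})
    (K : set 'rV[R]_D) (mu : 'I_D -> nat -> R) (p Theta : R) n :
  (0 < a)%N -> 0 < p -> (forall j c, 0 <= mu j c) ->
  (forall j, \sum_(0 <= c < a) mu j c = 1) ->
  (forall j, \sum_(i in S) mu j (i j) `^ p <= Theta) ->
  (forall l (v w : word S l), v != w -> word_edge K v w = near_words 1 v w) ->
  (conductance S K p n <= ((3 ^ D * (5 ^ D * D))%:R * Theta ^+ n)%:E)%E.
Proof.
move=> a0 p0 mu0 mu1 muT edgeE.
apply: ge_ereal_sup => _ [m [w [_ ->]]].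
have edge_near l (v v' : word S l) : word_edge K v v' -> near_words 1 v v'.
  by move=> e; rewrite -edgeE//; case/andP: e.
apply: le_trans (_ : (energy (@word_edge R D a S K (m + n)) p
  (@cutoff R D a S mu m n w))%:E <= _)%E; last first.
  by rewrite lee_fin; apply: energy_cutoff_le => // v v'; apply: edge_near.
apply: ereal_inf_lbound; exists (cutoff mu w) => //; split.
  by move=> v /imsetP[x _ ->]; apply: cutoff_eq1.
have [g gK Kg] := cat_tuple_bij S m n.
move=> v; rewrite -(Kg v); case: (g v) => u x /=; rewrite inE => far.
(* A word [u] near [w] equals [w] or is joined to it by one edge, so its cylinder lies in
   [nbhd_ball]. *)
apply: cutoff_eq0 => //; apply: contraNN far => near_u.
apply/bigcupP; exists u; last by apply/imsetP; exists x.
apply: ge_ereal_inf; have [->|uw] := eqVneq u w.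
  by exists 0%E; [exists [::]|rewrite lee_fin].
by exists 1%E => //; exists [:: w] => //; split; rewrite //= andbT edgeE.
Qed.

(** * Cells of the attractor and squares of the grid *)

Lemma simil_coord (R : realType) D a (i : gsc_index D a) (x : 'rV[R]_D) j :
  (0 < a)%N ->
  a%:R * simil i x 0 j = x 0 j + 2 * (i j : nat)%:R - (a%:R - 1).
Proof.
move=> a0; have a0' : a%:R != 0 :> R by rewrite pnatr_eq0 -lt0n.
rewrite /simil !mxE summxE (bigD1 j)//= big1 => [|k kj]; last first.
  by rewrite mxE eq_sym (negbTE kj) andbF.
rewrite mxE !eqxx/= mulr1n addr0. by field.
Qed.

(** Adding 1 moves the lower corner of [Q0] to the origin, where composing the maps becomes base-[a]
    expansion; [Q0] has side 2, hence the factor 2. *)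
Lemma simil_word_coord (R : realType) D a (S : {set gsc_index D a}) n
    (w : word S n) (x : 'rV[R]_D) j :
  (0 < a)%N ->
  a%:R ^+ n * (simil_word w x 0 j + 1) = x 0 j + 2 * (word_coord j w)%:R + 1.
Proof.
move=> a0; rewrite /simil_word; case: w => w /= /eqP <-.
elim: w => [|h w IH]/=; first by rewrite expr0; ring.
rewrite exprS mulrAC mulrDr mulr1 simil_coord//.
rewrite !natrD natrM natrX; move: IH; set y := fun_of_matrix (foldr _ _ _ _) _ _.
move: (a%:R ^+ size w) (word_coord j w)%:R (val h j : nat)%:R => q c d IH.
transitivity (q * (y + 1) + 2 * (d * q)); first by ring.
by rewrite IH; ring.
Qed.

(** If [y = simil i z], the excess satisfies [a * (|y_j| - 1) <= |z_j| - 1]. Pulling back [n] times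
    inside the bounded set [K] bounds [a ^ n * (|x_j| - 1)] for every [n], so the excess is not
    positive. *)
Lemma attractor_sub_Q0 (R : realType) D a (S : {set gsc_index D a})
    (K : set 'rV[R]_D) : (2 <= a)%N -> self_similar_set S K -> K `<=` @Q0 R D.
Proof.
move=> a2 [_ cK KE] x Kx j; rewrite -ler_norml.
have : compact ((fun x : 'rV[R]_D => x 0 j) @` K).
  apply: continuous_compact => //; apply: continuous_subspaceT.
  exact: coord_continuous.
move=> /compact_bounded[M [_ /(_ (`|M| + 1))]] bound.
have {}bound y : K y -> `|y 0 j| <= `|M| + 1.
  by move=> Ky; apply: bound; [rewrite ltr_pwDr// ler_norm|exists y].
have a0 : 0 < a%:R :> R by rewrite ltr0n; apply: leq_trans a2.
have shrink n y : K y -> a%:R ^+ n * (`|y 0 j| - 1) <= `|M|.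
  elim: n y => [|n IH] y Ky; first by rewrite expr0 mul1r lerBlDr bound.
  move: (Ky); rewrite KE => -[i Si [z Kz zy]].
  apply: le_trans (IH _ Kz); rewrite exprSr -mulrA ler_pM2l ?exprn_gt0//.
  have ia : (i j : nat)%:R + 1 <= a%:R :> R by rewrite natr1 ler_nat.
  have i0 : 0 <= (i j : nat)%:R :> R by [].
  have -> : a%:R * (`|y 0 j| - 1) =
      `|z 0 j + 2 * (i j : nat)%:R - (a%:R - 1)| - a%:R.
    rewrite -simil_coord ?(ltnW a2)// zy normrM (ger0_norm (ltW a0)).
    by rewrite mulrBr mulr1.
  have zl := ler_norm (z 0 j); have := ler_norm (- z 0 j); rewrite normrN => zl'.
  rewrite lerBlDr ler_norml; move: (`|z 0 j|) zl zl' ia i0 => u *.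
  by apply/andP; split; lra.
rewrite leNgt; apply/negP => x1.
have [N] : exists N : nat, `|M| / (`|x 0 j| - 1) < N%:R.
  exists (Num.bound (`|M| / (`|x 0 j| - 1))); apply: archi_boundP.
  by rewrite divr_ge0// subr_ge0 ltW.
rewrite ltr_pdivrMr ?subr_gt0// => NM.
have := shrink N x Kx; apply/negP; rewrite -ltNge; apply: lt_le_trans NM _.
rewrite ler_pM2r ?subr_gt0// -natrX ler_nat; apply/ltnW.
exact: ltn_expl.
Qed.

(** Iterating the contraction from any point of [K] stays in the closed set [K] and converges to
    [e]. *)
Lemma fixed_point_in_attractor (R : realType) D a (S : {set gsc_index D a})
    (K : set 'rV[R]_D) (i : gsc_index D a) (e : 'rV[R]_D) :
  (2 <= a)%N -> self_similar_set S K -> i \in S -> simil i e = e -> K e.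
Proof.
move=> a2 [[x0 Kx0] cK KE] iS ie.
have sim x : simil i x = e + a%:R^-1 *: (x - e).
  have -> : simil i x = simil i e + a%:R^-1 *: (x - e).
    by apply/rowP => k; rewrite /simil !mxE; ring.
  by rewrite ie.
have iter n : K (e + (a%:R^-1) ^+ n *: (x0 - e)).
  elim: n => [|n IH]; first by rewrite expr0 scale1r addrC subrK.
  rewrite KE; exists i => //; exists (e + (a%:R^-1) ^+ n *: (x0 - e)) => //.
  by rewrite sim addrAC subrr add0r scalerA -exprS.
have clK : closed K by apply: compact_closed => //; exact: norm_hausdorff.
have cv : (fun n : nat => e + (a%:R^-1 : R) ^+ n *: (x0 - e)) @ \oo --> e.
  rewrite -[X in _ --> X]addr0; apply: cvgD; first exact: cvg_cst.
  rewrite -(scale0r (x0 - e)); apply: cvgZr_tmp; apply: cvg_expr.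
  by rewrite ger0_norm ?invr_ge0// invf_lt1 ?ltr1n// ltr0n; lia.
by apply: (closed_cvg K clK _ e cv); apply: nearW.
Qed.

Lemma word_edge_near (R : realType) D a (S : {set gsc_index D a})
    (K : set 'rV[R]_D) n (v w : word S n) :
  (0 < a)%N -> K `<=` @Q0 R D ->
  (forall s : 'I_D -> bool, K (\row_j (-1) ^+ s j)) ->
  v != w -> word_edge K v w = near_words 1 v w.
Proof.
move=> a0 KQ0 cornerK vw; rewrite /word_edge vw/=.
have an0 : a%:R ^+ n != 0 :> R by rewrite expf_neq0// pnatr_eq0 -lt0n.
apply/asboolP/forallP => [[_ [[x Kx <-] [y Ky yx]]] j|vw1].
  have := simil_word_coord v x j a0.
  rewrite -yx simil_word_coord// => e.
  have /andP[x1 x2] := KQ0 _ Kx j; have /andP[y1 y2] := KQ0 _ Ky j.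
  by rewrite -!(ler_nat R) !natrD; apply/andP; split; lra.
(* The shared corner: on each axis the side of [v] facing [w], and the upper side for both when the
   coordinates agree. *)
exists (simil_word v (\row_j (-1) ^+ (word_coord j w < word_coord j v)%N)).
split.
  by exists (\row_j (-1) ^+ (word_coord j w < word_coord j v)%N).
exists (\row_j (-1) ^+ (word_coord j v < word_coord j w)%N) => //.
apply/rowP => j; apply: (addIr 1); apply: (mulfI an0).
rewrite !simil_word_coord// !mxE; have := vw1 j.
case: (ltngtP (word_coord j v) (word_coord j w)) => /= [lt|lt|->] // /andP[le1 le2].
- have -> : word_coord j w = (word_coord j v).+1 by lia.
  by rewrite -natr1 expr0 expr1; ring.
- have -> : word_coord j v = (word_coord j w).+1 by lia.
  by rewrite -natr1 expr0 expr1; ring.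
Qed.

(* The hypotheses on [y] say that [simil i y] lies in no other cell of the
   grid. *)
Lemma mem_of_Q1 (R : realType) D a (S : {set gsc_index D a})
    (i : gsc_index D a) (y : 'rV[R]_D) :
  (0 < a)%N -> Q1 S (simil i y) ->
  (forall j, [\/ -1 < y 0 j < 1, y 0 j = 1 /\ i j = a.-1 :> nat |
                 y 0 j = -1 /\ i j = 0%N :> nat]) ->
  i \in S.
Proof.
move=> a0 [i' Si' [y' Qy' E]] hy.
suff -> : i = i' by exact: Si'.
apply/ffunP => j; apply/val_inj/eqP => /=.
have := simil_coord i y j a0; rewrite -E simil_coord// => e.
have /andP[y'1 y'2] := Qy' j; have i'a := ltn_ord (i' j).
case: (hy j) => [/andP[y1 y2]|[y1 ij]|[y1 ij]].
- rewrite eqn_leq -(ltnS (i j)) -(ltnS (i' j)) -!(ltr_nat R).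
  rewrite -(natr1 (i j)) -(natr1 (i' j)).
  by apply/andP; split; lra.
- by rewrite eqn_leq -(ler_nat R); apply/andP; split; [lra|rewrite ij -ltnS prednK].
- rewrite y1 ij in e; rewrite ij eq_sym -leqn0 -(ler_nat R); lra.
Qed.

(** * Unequal columns *)

(** Overwriting the [j]-th digit by [c] embeds the slice through [i0] into the full slice; the image
    of the missing cell [i0] is not attained. *)
Lemma card_slice_lt D a (S : {set gsc_index D a}) (j : 'I_D) (c : 'I_a)
    (i0 : gsc_index D a) :
  (forall i : gsc_index D a, i j = c -> i \in S) -> i0 \notin S ->
  (#|[set i in S | i j == i0 j]%SET| < #|[set i in S | i j == c]%SET|)%N.
Proof.
move=> fullc i0S.
pose upd (i : gsc_index D a) : gsc_index D a :=
  [ffun k => if k == j then c else i k].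
have upd_inj : {in [set i : gsc_index D a | i j == i0 j]%SET &, injective upd}.
  move=> i i'; rewrite !inE => /eqP ij /eqP i'j /ffunP E.
  apply/ffunP => k; have := E k; rewrite !ffunE.
  by case: eqP => // -> _; rewrite ij.
have sub : [set i in S | i j == i0 j]%SET
    \subset [set i : gsc_index D a | i j == i0 j]%SET.
  by apply/fintype.subsetP => i; rewrite !inE => /andP[].
rewrite -(card_in_imset (sub_in2 (fintype.subsetP sub) upd_inj)).
apply: proper_card; apply/properP; split.
  apply/fintype.subsetP => _ /imsetP[i _ ->]; rewrite inE ffunE eqxx eqxx andbT.
  by apply: fullc; rewrite ffunE eqxx.
exists (upd i0); first by rewrite inE fullc ffunE eqxx ?eqxx.
apply/imsetP => -[i]; rewrite inE => /andP[iS ij] /upd_inj E.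
by move: i0S; rewrite E ?iS// inE.
Qed.

Lemma axis_weights (R : realType) D a (S : {set gsc_index D a}) (p : R)
    (j : 'I_D) (c : 'I_a) :
  0 < p -> (forall i : gsc_index D a, i j = c -> i \in S) ->
  S \proper [set: gsc_index D a]%SET ->
  exists mu : nat -> R, [/\ forall k, 0 <= mu k,
    \sum_(0 <= k < a) mu k = 1 &
    \sum_(i in S) mu (i j) `^ p < #|S|%:R * a%:R^-1 `^ p].
Proof.
move=> p0 fullc /properP[_ [i0 _ i0S]].
pose N k : R := #|[set i in S | i j == k]%SET|%:R.
have sumN (F : 'I_a -> R) : \sum_(i in S) F (i j) = \sum_k N k * F k.
  rewrite (partition_big (fun i : gsc_index D a => i j) xpredT)//=.
  apply: eq_bigr => k _; rewrite /N mulr_natl -sumr_const.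
  by apply: eq_big => [i|i /andP[_ /eqP ->]//]; rewrite inE.
have [||mu [mu0 mu1 muT]] := @nonuniform_weights R 'I_a N p c (i0 j) p0.
- by [].
- by rewrite ltr_nat; apply: card_slice_lt.
(* Extension by 0 from ['I_a] to [nat], where the digits of [digit_mass] live. *)
pose mu' k : R := if insub k is Some l then mu l else 0.
have mu'E (l : 'I_a) : mu' l = mu l by rewrite /mu' valK.
exists mu'; split.
- by move=> k; rewrite /mu'; case: insubP.
- by rewrite big_mkord -mu1; apply: eq_bigr => l _; rewrite mu'E.
- under eq_bigr do rewrite mu'E.
  rewrite (sumN (fun k => mu k `^ p)); apply: lt_le_trans muT _.
  rewrite card_ord; under eq_bigr do rewrite -[N _]mulr1.
  by rewrite -(sumN (fun=> 1)) sumr_const.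
Qed.

(** * Faces and corners of planar carpets *)

Lemma Q1_involution (R : realType) D a (S : {set gsc_index D a})
    (K : set 'rV[R]_D) (f : 'rV[R]_D -> 'rV[R]_D) (x : 'rV[R]_D) :
  generalized_sierpinski_carpet S K -> involutive f -> eucl_isometry f ->
  (forall y, Q0 y -> Q0 (f y)) -> Q1 S x -> Q1 S (f x).
Proof.
move=> gsc fK f_iso fQ0 Qx; rewrite -(gsc_symmetry gsc f_iso); first by exists x.
apply/seteqP; split => [_ [y Qy <-]|y Qy]; first exact: fQ0.
by exists (f y); [exact: fQ0|exact: fK].
Qed.

Lemma ord2P (j : 'I_2) : j = ord0 \/ j = ord_max.
Proof. by case: j => -[|[|//]] h; [left|right]; apply: val_inj. Qed.

Lemma eucl_isometry_rev (R : realType) D :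
  eucl_isometry (fun x : 'rV[R]_D => \row_k x 0 (rev_ord k)).
Proof.
move=> x y; rewrite /eucl_dist [in RHS](reindex_inj rev_ord_inj)/=.
by congr Num.sqrt; apply: eq_bigr => k _; rewrite !mxE.
Qed.

Lemma eucl_isometryN (R : realType) D : eucl_isometry (@GRing.opp 'rV[R]_D).
Proof.
move=> x y; rewrite /eucl_dist; congr Num.sqrt; apply: eq_bigr => k _.
by rewrite !mxE -opprD sqrrN.
Qed.

(** In the plane the segment of [gsc_border] is a whole side of the square. The midpoint of the
    outer side of a cell along it lies in no other cell, which forces the cell into [S]; swapping
    the axes gives the other side. *)
Lemma gsc_face (R : realType) a (S : {set gsc_index 2 a}) (K : set 'rV[R]_2)
    (i : gsc_index 2 a) (j : 'I_2) :
  generalized_sierpinski_carpet S K -> i j = a.-1 :> nat -> i \in S.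
Proof.
move=> gsc ij; have a3 := gsc_scale gsc; have a0 : (0 < a)%N by lia.
have a0' : a%:R != 0 :> R by rewrite pnatr_eq0 -lt0n.
have ap : 0 < a%:R :> R by rewrite ltr0n.
pose y (j : 'I_2) : 'rV[R]_2 := \row_k (k == j)%:R.
have yE j' k : y j' 0 k = (k == j')%:R by rewrite mxE.
have top (i' : gsc_index 2 a) : i' ord_max = a.-1 :> nat ->
    Q1 S (simil i' (y ord_max)).
  move=> i'1; apply: (gsc_border gsc) => k.
  have := simil_coord i' (y ord_max) k a0; rewrite yE.
  have [->|->] := ord2P k; rewrite /= => E.
    have i'0 : (i' ord0 : nat)%:R + 1 <= a%:R :> R by rewrite natr1 ler_nat.
    have i'0' : 0 <= (i' ord0 : nat)%:R :> R by [].
    by apply/andP; split; rewrite -(ler_pM2l ap) E; lra.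
  apply/eqP/(mulfI a0'); rewrite E i'1 -subn1 natrB//; ring.
suff Qi : Q1 S (simil i (y j)).
  apply: (mem_of_Q1 a0 Qi) => k; rewrite yE.
  case: eqVneq => [->|_]; first by constructor 2.
  by constructor 1; rewrite ltrN10 ltr01.
have [j0|j1] := ord2P j; last by rewrite j1 in ij *; apply: top.
pose rev (x : 'rV[R]_2) : 'rV[R]_2 := \row_k x 0 (rev_ord k).
pose i' : gsc_index 2 a := [ffun k => i (rev_ord k)].
have -> : simil i (y j) = rev (simil i' (y ord_max)).
  apply/rowP => k; rewrite [RHS]mxE; apply: (mulfI a0'); rewrite !simil_coord//.
  rewrite ffunE rev_ordK !yE j0; congr (_%:R + _ - _).
  by have [->|->] := ord2P k.
apply: (Q1_involution gsc).
- by move=> x; apply/rowP => k; rewrite !mxE rev_ordK.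
- exact: eucl_isometry_rev.
- by move=> x Qx k; rewrite mxE; apply: Qx.
- apply: top; rewrite ffunE -ij j0; congr (nat_of_ord (i _)); exact: val_inj.
Qed.

(** Each corner is the fixed point of the map of its corner cell, so it suffices that this cell is
    in [S]. *)
Lemma corner_in_gsc (R : realType) a (S : {set gsc_index 2 a})
    (K : set 'rV[R]_2) (s : 'I_2 -> bool) :
  generalized_sierpinski_carpet S K -> K (\row_j (-1) ^+ s j).
Proof.
move=> gsc; have a3 := gsc_scale gsc; have a0 : (0 < a)%N by lia.
have a0' : a%:R != 0 :> R by rewrite pnatr_eq0 -lt0n.
have alt : (a.-1 < a)%N by lia.
pose i : gsc_index 2 a := [ffun j => if s j then Ordinal a0 else Ordinal alt].
have a1 : a.-1%:R = a%:R - 1 :> R by rewrite -subn1 natrB.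
apply: (@fixed_point_in_attractor _ _ _ S K i).
- exact: ltnW.
- exact: gsc_attractor gsc.
(* A corner with some coordinate 1 lies on a side covered by [gsc_face]; the remaining corner is
   opposite to the cell [m] and is reached by [x |-> - x]. *)
- have [[j sj]|/forallNP sj] := pselect (exists j, s j = false).
    by apply: (@gsc_face _ _ _ _ _ j gsc); rewrite ffunE sj.
  pose m : gsc_index 2 a := [ffun=> Ordinal alt].
  pose e : 'rV[R]_2 := const_mx 1.
  have Qm : Q1 S (simil m e).
    exists m; first by apply: (@gsc_face _ _ _ _ _ ord0 gsc); rewrite ffunE.
    by exists e => // j; rewrite mxE; apply/andP; split; lra.
  apply: (@mem_of_Q1 _ _ _ _ _ (- e) a0).
    have -> : simil i (- e) = - simil m e.
      apply/rowP => j; rewrite [RHS]mxE; apply: (mulfI a0').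
      rewrite mulrN !simil_coord// !mxE !ffunE a1.
      by case: ifP => [_ /=|/sj//]; ring.
    apply: (Q1_involution gsc) => //; first exact: opprK.
      exact: eucl_isometryN.
    by move=> x Qx j; have /andP[] := Qx j; rewrite mxE lerN2 lerNl => -> ->.
  move=> j; constructor 3; rewrite !mxE ffunE; split => //.
  by case: ifP => // /sj.
- apply/rowP => j; apply: (mulfI a0'); rewrite simil_coord// !mxE ffunE.
  by case: (s j); rewrite /= ?a1 ?expr0 ?expr1; ring.
Qed.

(** * Passing to the scaling factor *)

(** A letter of [S] makes the family non-empty; the supremum of an empty one would be [-oo]. *)
Lemma conductance_ge0 (R : realType) D a (S : {set gsc_index D a})
    (K : set 'rV[R]_D) (p : R) n :
  S != finset.set0 -> (0 <= conductance S K p n)%E.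
Proof.
move=> /set0Pn[i iS]; pose w : word S 1 := [tuple exist _ i iS].
apply: (@le_trans _ _ (capacity (@word_edge R D a S K (1 + n)) p
    (cylinder n w) (~: nbhd_ball K n w)%SET)).
  apply: le_ereal_inf_tmp => _ [f _ <-]; rewrite lee_fin /energy.
  by rewrite mulr_ge0// sumr_ge0// => e _; apply: powR_ge0.
by apply: ereal_sup_ubound; exists 1%N, w.
Qed.

(** Since [q < r], eventually [C * q ^+ n <= r ^+ n], which absorbs the constant before roots are
    taken and also covers [q = 0]. *)
Lemma cvg_root_le (R : realType) (c : nat -> \bar R) (C q r l : R) :
  0 <= q -> q < r -> (forall n, 0 <= c n)%E ->
  (forall n, c n <= (C * q ^+ n)%:E)%E ->
  (fun n => (c n `^ n%:R^-1)%E) @ \oo --> l%:E -> l <= r.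
Proof.
move=> q0 qr c0 cC cl; have r0 : 0 < r by apply: le_lt_trans qr.
have cv : (fun n => C * (q / r) ^+ n) @ \oo --> (0 : R).
  rewrite -(mulr0 C); apply: cvgM; [exact: cvg_cst|apply: cvg_expr].
  by rewrite ger0_norm ?divr_ge0 ?(ltW r0)// ltr_pdivrMr// mul1r.
rewrite -lee_fin; apply: (cvge_le _ cl).
near=> n.
have n0 : n%:R != 0 :> R by rewrite pnatr_eq0 -lt0n; near: n; exists 1%N.
have Cr : C * q ^+ n <= r ^+ n.
  rewrite -[leRHS]mul1r -ler_pdivrMr ?exprn_gt0// -mulrA -expr_div_n.
  near: n; exact: (cvgr_le _ cv _ ltr01).
have -> : r%:E = ((r ^+ n)%:E `^ n%:R^-1)%E.
  by rewrite poweR_EFin -powR_mulrn ?(ltW r0)// -powRrM mulfV// powRr1 ?(ltW r0).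
apply: gt0_ler_poweR; rewrite ?invr_ge0// ?in_itv/= ?leey ?andbT ?lee_fin//.
  by rewrite exprn_ge0// ltW.
by apply: le_trans (cC n) _; rewrite lee_fin.
Unshelve. all: by end_near. Qed.

Theorem theorem2p27 (R : realType) (D a : nat) (S : {set gsc_index D a})
    (K : set 'rV[R]_D) (p rho : R) :
  generalized_sierpinski_carpet S K -> D = 2%N -> 0 < p ->
  is_scaling_factor S K p rho ->
  #|S|%:R^-1 * a%:R `^ p < rho /\ p < beta_exponent S rho.
Proof.
move=> gsc D2 p0 [rho0 cv_rho]; subst D.
have a3 := gsc_scale gsc; have a0 : (0 < a)%N by lia.
have alt : (a.-1 < a)%N by lia.
have ap : 0 < a%:R :> R by rewrite ltr0n.
have S0 : 0 < #|S|%:R :> R by rewrite ltr0n card_gt0; exact: gsc_neq0 gsc.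
have /choice[mu muP] (j : 'I_2) : exists mu : nat -> R, [/\ forall k, 0 <= mu k,
    \sum_(0 <= k < a) mu k = 1 &
    \sum_(i in S) mu (i j) `^ p < #|S|%:R * a%:R^-1 `^ p].
  apply: (@axis_weights _ _ _ _ _ _ (Ordinal alt)) => //.
    by move=> i ij; apply: (gsc_face (j := j) gsc); rewrite ij.
  exact: gsc_proper gsc.
(* A single [Theta] has to serve both axes, hence the maximum. *)
pose q := \big[Num.max/0]_j (\sum_(i in S) mu j (i j) `^ p).
have qlt : q < #|S|%:R * a%:R^-1 `^ p.
  apply: bigmax_lt => [|j _]; first by rewrite mulr_gt0// powR_gt0// invr_gt0.
  by have [] := muP j.
have q0 : 0 <= q by apply: bigmax_ge_id.
(* The midpoint [r] keeps the final inequality strict, as the limit only gives [rho^-1 <= r]. *)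
have /midf_lt[qr rlt] := qlt; set r := _ / _ in qr rlt.
have condP n : (conductance S K p n <= ((3 ^ 2 * (5 ^ 2 * 2))%:R * q ^+ n)%:E)%E.
  apply: (@conductance_le _ _ _ _ _ mu) => //.
  - by move=> j; have [] := muP j.
  - by move=> j; have [] := muP j.
  - by move=> j; apply: (le_bigmax _ (fun j => \sum_(i in S) mu j (i j) `^ p)).
  - move=> l v w; apply: word_edge_near => //.
      by apply: attractor_sub_Q0 (gsc_attractor gsc); exact: ltnW.
    by move=> s; apply: corner_in_gsc gsc.
have rhoV : rho^-1 < #|S|%:R * a%:R^-1 `^ p.
  apply: le_lt_trans rlt; apply: cvg_root_le q0 qr _ condP cv_rho => n.
  exact: conductance_ge0 (gsc_neq0 gsc).
have aV : a%:R^-1 `^ p = (a%:R `^ p)^-1 :> R.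
  by rewrite -powR_inv1 ?ltW// -powRrM mulN1r powRN.
have main : a%:R `^ p < #|S|%:R * rho.
  have app : 0 < a%:R `^ p :> R by rewrite powR_gt0.
  have := rhoV; rewrite aV -(ltr_pM2r (mulr_gt0 rho0 app)).
  by rewrite mulKf ?gt_eqF// mulrCA divfK ?gt_eqF// mulrC.
split; first by rewrite mulrC ltr_pdivrMr// mulrC.
rewrite /beta_exponent ltr_pdivlMr; last by rewrite ln_gt0// ltr1n; exact: ltnW.
by rewrite -ln_powR ltr_ln// posrE ?powR_gt0// mulr_gt0.
Qed.
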